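(* Let $X$ be a non-negative random variable with decreasing pdf $f$ such that $f(0)\leq1$, let $n$ be a positive integer, and let $\alpha>0$, $\alpha\neq1$. Then $$S_{\alpha}(\boldsymbol X_{\rm MRSSU})\geq S_{\alpha}(\boldsymbol U_{\rm MRSSU}),$$ where $$S_{\alpha}(\boldsymbol U_{\rm MRSSU})=\frac{1}{\alpha-1}\left(1-\frac{(n!)^{\alpha}}{\prod_{i=1}^{n}(1+\alpha(i-1))}\right).$$
   Context: $X$ is non-negative and absolutely continuous with pdf $f$ and cdf $F$; $F^{-1}$ is the right-continuous inverse of $F$. $\boldsymbol X_{\rm MRSSU}$ (maximum ranked set sampling with unequal samples, size $n$) is a vector of $n$ independent random variables whose $i$-th component is the maximum of a simple random sample of size $i$ from $X$. Its Tsallis entropy of order $\alpha>0$, $\alpha\ne1$, is $$S_{\alpha}(\boldsymbol X_{\rm MRSSU})=\frac{1}{1-\alpha}\left(\prod_{i=1}^{n}\left[\int_{0}^{1}i^{\alpha}u^{\alpha(i-1)}f^{\alpha-1}(F^{-1}(u))\,du\right]-1\right),$$ where $f^{\alpha-1}(F^{-1}(u))=[f(F^{-1}(u))]^{\alpha-1}$. $S_{\alpha}(\boldsymbol U_{\rm MRSSU})$ is the same quantity for $U$ uniform on $(0,1)$. *)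

(* Defs.v *)
From HB Require Import structures.
From mathcomp Require Import all_boot all_order all_algebra.
From mathcomp Require Import all_classical all_reals all_analysis.

Set Implicit Arguments.
Unset Strict Implicit.
Unset Printing Implicit Defensive.

Import Order.TTheory GRing.Theory Num.Theory.
Import numFieldNormedType.Exports.

Local Open Scope classical_set_scope.
Local Open Scope ring_scope.

Definition is_pdf (R : realType) (d : measure_display) (T : measurableType d)
    (P : probability T R) (X : {RV P >-> R}) (f : R -> R) : Prop :=
  [/\ measurable_fun setT f, (forall x, 0 <= f x) &
      forall A : set R, measurable A ->
        distribution P X A = (\int[lebesgue_measure]_(x in A) (f x)%:E)%E].

(* The right-continuous inverse F^-1(u) = inf {x | F(x) > u} of the cdf F of X.
   The infimum is meaningful for 0 < u < 1; for a set that is empty or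
   unbounded below, [inf] is 0, which affects integrals over u in [0, 1] only
   at the endpoints. *)
Definition cdf_inv (R : realType) (d : measure_display) (T : measurableType d)
    (P : probability T R) (X : {RV P >-> R}) (u : R) : R :=
  inf [set x : R | (u%:E < cdf X x)%E].

(* Tsallis entropy of order a of the maximum ranked set sample with unequal
   samples, of size n, drawn from X with density f.  It takes values in \bar R
   because the integrals may diverge.  [0 `^ r] is 0 also when r < 0, but
   f (F^-1 u) = 0 happens only for u in a null set, f being a density of X. *)
Definition tsallis_MRSSU (R : realType) (d : measure_display)
    (T : measurableType d) (P : probability T R) (X : {RV P >-> R})
    (f : R -> R) (n : nat) (a : R) : \bar R :=
  (((1 - a)^-1)%:E *
   (\prod_(1 <= i < n.+1)
      \int[lebesgue_measure]_(u in `[0%R, 1%R])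
        (i%:R `^ a * u `^ (a * (i%:R - 1)) *
         f (cdf_inv X u) `^ (a - 1))%:E
    - 1))%E.

(* Main.v *)
Require Import Defs.
From HB Require Import structures.
From mathcomp Require Import all_boot all_order all_algebra.
From mathcomp Require Import all_classical all_reals all_analysis.
From mathcomp Require Import measurable_realfun lra.

Import Order.TTheory GRing.Theory Num.Theory.
Import numFieldNormedType.Exports.

Local Open Scope classical_set_scope.
Local Open Scope ring_scope.

(** On [0, 1], both f(F^-1(u)) <= f 0 <= 1 and f(F^-1(u)) > 0 hold, whereas the
    density of U is identically 1 at its quantiles.  Hence f(F^-1(u))^(a-1) is
    at least 1 for a < 1 and at most 1 for a > 1; each factor of the product
    compares accordingly with that of U, and the sign of 1/(1-a) turns both
    cases into the same inequality.  The factors for U are integrals of powers,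
    i^a / (1 + a(i-1)). *)

(** A simple function below [g] is also below [h], so the supremum defining the integral can only
    grow. Measurability of [f (cdf_inv X u)] in [u] thus never has to be discussed. *)
Lemma ge0_le_integral_nonmeasurable (R : realType) (d : measure_display)
    (T : measurableType d) (mu : {measure set T -> \bar R}) (D : set T)
    (g h : T -> \bar R) :
  (forall x, D x -> 0 <= g x)%E -> (forall x, D x -> g x <= h x)%E ->
  (\int[mu]_(x in D) g x <= \int[mu]_(x in D) h x)%E.
Proof.
move=> g0 gh; rewrite !ge0_integralE//; last first.
  by move=> x Dx; exact: le_trans (g0 x Dx) (gh x Dx).
apply: ub_ereal_sup => _ [s sg <-]; apply: ereal_sup_ubound; exists s => //= x.
apply: le_trans (sg x) _.
by apply: lee_restrict.
Qed.

Lemma lee_prod_nat (R : realType) (m n : nat) (g h : nat -> \bar R) :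
  (forall i, 0 <= g i)%E -> (forall i, (m <= i)%N -> g i <= h i)%E ->
  (\prod_(m <= i < n) g i <= \prod_(m <= i < n) h i)%E.
Proof.
move=> g0 gh; rewrite big_nat_cond [leRHS]big_nat_cond.
(* Nonnegativity is carried through the induction: products in [\bar R] are monotone only for
   nonnegative factors. *)
suff /andP[] : (0 <= \prod_(m <= i < n | (m <= i < n)%N && true) g i <=
   \prod_(m <= i < n | (m <= i < n)%N && true) h i)%E by [].
elim/big_ind2 : _ => //= [|x1 x2 y1 y2 /andP[x10 x12] /andP[y10 y12]|i].
- by rewrite lee01 lexx.
- by rewrite mule_ge0//= lee_pmul.
- by rewrite andbT => /andP[mi _]; rewrite g0 gh.
Qed.

(** Boundary data for the fundamental theorem of calculus. A power with [c < 1] has no derivative at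
    0, so the limit there comes from [powR_cvg0]. *)
Lemma powR_LRcontinuous (R : realType) (c : R) : 0 < c ->
  derivable_oo_LRcontinuous (@powR R ^~ c) 0 1.
Proof.
move=> c0; split.
- move=> x; rewrite in_itv/= => /andP[x0 _].
  by apply: derivable_powR; rewrite in_itv/= x0.
- by rewrite powR0 ?gt_eqF//; exact: powR_cvg0.
- have /derivable1_diffP/differentiable_continuous :
      derivable (@powR R ^~ c) 1 1.
    by apply: derivable_powR; rewrite in_itv/= ltr01.
  exact: cvg_at_left_filter.
Qed.

Lemma integral01_powR (R : realType) (b : R) : 0 <= b ->
  (\int[lebesgue_measure]_(u in `[0%R, 1%R]) (u `^ b)%:E = ((1 + b)^-1)%:E)%E.
Proof.
(* The exponent 0 is treated apart: the integrand is then constantly 1, at 0 too, while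
   [powR_LRcontinuous] asks for a positive exponent. *)
rewrite le_eqVlt => /predU1P[<-|b0].
  under eq_integral do rewrite powRr0.
  by rewrite integral_cst//= mul1e lebesgue_measure_itv/= lte01 oppr0 adde0
    addr0 invr1.
have b10 : 0 < b + 1 by lra.
rewrite (@continuous_FTC2 _ _ (fun x => (b + 1)^-1 * x `^ (b + 1)))//.
- by rewrite powR1 powR0 ?gt_eqF// mulr0 mulr1 sube0 addrC.
- exact/derivable_oo_LRcontinuous_within/powR_LRcontinuous.
- have [dF F0 F1] := powR_LRcontinuous _ _ b10; split.
  + by move=> x x01; apply: derivableM => //; exact: dF.
  + by apply: cvgM => //; exact: cvg_cst.
  + by apply: cvgM => //; exact: cvg_cst.
- move=> x; rewrite in_itv/= => /andP[x0 _].
  have dP := is_derive1_powR (b + 1) x0.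
  rewrite derive1E derive_val addrK -[LHS]/(_ * (_ * _)).
  by rewrite mulrA mulVf ?gt_eqF// mul1r.
Qed.

Section nonnegative_random_variable.
Context (R : realType) (d : measure_display) (T : measurableType d)
  (P : probability T R) (X : {RV P >-> R}).
Context (X0 : distribution P X `]-oo, 0[ = 0%E).

Lemma cdf_lt0 (x : R) : x < 0 -> cdf X x = 0%E.
Proof.
move=> x0; apply/eqP; rewrite eq_le cdf_ge0 andbT -X0.
by apply: le_measure; rewrite ?inE//; exact: subset_itvl.
Qed.

Lemma cdf_inv_ge0 (u : R) : 0 <= u -> 0 <= cdf_inv X u.
Proof.
move=> u0; rewrite /cdf_inv; set E := [set x | _].
have [->|/set0P E0] := eqVneq E set0; first by rewrite inf0.
apply: lb_le_inf => // x /=; rewrite /E/= => ux.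
rewrite leNgt; apply/negP => /cdf_lt0 Fx0.
by move: ux; rewrite Fx0 lte_fin ltNge u0.
Qed.

Lemma cdf_inv_le (u x : R) : 0 <= u -> (u%:E < cdf X x)%E -> cdf_inv X u <= x.
Proof.
move=> u0 ux; apply: ge_inf => //; exists 0 => z /= uz.
rewrite leNgt; apply/negP => /cdf_lt0 Fz0.
by move: uz; rewrite Fz0 lte_fin ltNge u0.
Qed.

(** The set is empty and [inf] takes its default value 0. This lets pointwise bounds hold on all of
    the closed interval. *)
Lemma cdf_inv1 : cdf_inv X 1 = 0.
Proof.
rewrite /cdf_inv (_ : [set x | _] = set0) ?inf0// -subset0 => x /=.
by rewrite ltNge cdf_le1.
Qed.

Lemma pdf_cdf_inv_gt0 (f : R -> R) (u : R) : is_pdf X f ->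
  (forall x y : R, 0 <= x -> x <= y -> f y <= f x) -> f 0 <= 1 ->
  0 <= u <= 1 -> 0 < f (cdf_inv X u).
Proof.
move=> [mf f0 Pf] f_decr f01.
have lt1 v : 0 <= v -> v < 1 -> 0 < f (cdf_inv X v).
  move=> v0 v1; have q0 := cdf_inv_ge0 _ v0; set q := cdf_inv X v in q0 *.
  (* If f q = 0 then, f being decreasing, X has no mass above q; as f <= 1 on
     [0, +oo[, P(X > q - e) <= e for all e > 0, so F > v already before q. *)
  rewrite ltNge; apply/negP => fq0.
  (* Any gap strictly between 0 and [1 - v] would do: a tail of at most that mass leaves [cdf X y]
     above [v]. *)
  pose y := q - (1 - v) / 2.
  have yq : y < q by rewrite /y; lra.
  suff : (ccdf X y <= ((1 - v) / 2)%:E)%E.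
    rewrite ccdf_1_cdf => Fy.
    suff : q <= y by rewrite leNgt yq.
    apply: cdf_inv_le => //.
    have Ffin : cdf X y \is a fin_num by rewrite fin_num_measure.
    move: Fy; rewrite -(fineK Ffin) -EFinB lee_fin lte_fin; lra.
  (* [y] may be negative, whereas [f] is controlled only on the nonnegative half-line; the rest
     carries no mass. *)
  pose A := `]y, +oo[%classic `&` `[0%R, +oo[%classic.
  apply: (@le_trans _ _ (distribution P X (`]-oo, 0[ `|` A))).
    apply: le_measure; rewrite ?inE//.
      by apply: measurableU => //; exact: measurableI.
    move=> x /= yx; have [x0|x0] := ltP x 0; [left|right] => //=.
    by split => //; rewrite /= in_itv/= andbT.
  apply: le_trans (measureU2 _ _ _) _ => //; first exact: measurableI.
  rewrite [X in (X + _)%E]X0 add0e [leLHS]Pf; last exact: measurableI.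
  apply: (@le_trans _ _ (\int[lebesgue_measure]_(x in A) (\1_`[y, q] x)%:E)%E).
    apply: ge0_le_integral_nonmeasurable => x [/=]; rewrite !in_itv/= !andbT => yx x0.
      by rewrite lee_fin.
    rewrite lee_fin indicE; have [xq|qx] := leP x q.
      rewrite mem_set ?(le_trans (f_decr 0 x _ _))//=.
      by rewrite in_itv/= xq ltW.
    apply: le_trans (f_decr q x q0 (ltW qx)) _.
    by apply: le_trans fq0 _.
  rewrite integral_indic//; last exact: measurableI.
  apply: (@le_trans _ _ (lebesgue_measure `[y, q])).
    apply: le_measure; rewrite ?inE//.
    by apply: measurableI => //; exact: measurableI.
  rewrite lebesgue_measure_itv/= lte_fin yq -EFinB lee_fin /y; lra.
move=> /andP[u0]; rewrite le_eqVlt => /predU1P[->|]; last exact: lt1.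
(* At [u = 1] the value is [f 0], which dominates the value at [u = 0], already known to be
   positive. *)
rewrite cdf_inv1; apply: lt_le_trans (lt1 0 _ _) _ => //.
by apply: f_decr => //; exact: cdf_inv_ge0.
Qed.

End nonnegative_random_variable.

Section uniform_random_variable.
Context (R : realType) (d : measure_display) (T : measurableType d)
  (P : probability T R) (U : {RV P >-> R}).
Context (U_unif : is_pdf U (uniform_pdf 0 1)).

Lemma uniform_lt0 : distribution P U `]-oo, 0[ = 0%E.
Proof.
have [_ _ ->//] := U_unif.
apply: integral0_eq => x /=; rewrite in_itv/= => x0.
by rewrite /uniform_pdf leNgt x0.
Qed.

(** It suffices to place the quantile in the unit interval: for [u < 1], [cdf U 1 = 1] exceeds [u],
    and for [u = 1] the quantile is the default 0. *)
Lemma uniform_pdf_cdf_inv (u : R) : 0 <= u <= 1 ->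
  uniform_pdf 0 1 (cdf_inv U u) = 1.
Proof.
move=> /andP[u0 u1]; rewrite /uniform_pdf cdf_inv_ge0//=; last exact: uniform_lt0.
suff -> : cdf_inv U u <= 1 by rewrite subr0 invr1.
move: u1; rewrite le_eqVlt => /predU1P[->|u1]; first by rewrite cdf_inv1.
apply: cdf_inv_le => //; first exact: uniform_lt0.
rewrite /cdf; have [_ _ ->//] := U_unif.
by rewrite integral_uniform_pdf1//=; exact: subset_itvr.
Qed.

End uniform_random_variable.

Lemma prod_powR (R : realType) (m n : nat) (F : nat -> R) (a : R) :
  (forall i, 0 <= F i) ->
  \prod_(m <= i < n) (F i `^ a) = (\prod_(m <= i < n) F i) `^ a.
Proof.
move=> F0; suff [] : \prod_(m <= i < n) (F i `^ a) =
  (\prod_(m <= i < n) F i) `^ a /\ 0 <= \prod_(m <= i < n) F i by [].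
elim/big_ind2 : _ => //= [|x1 x2 y1 y2 [-> x20] [-> y20]].
- by rewrite powR1.
- by rewrite powRM// mulr_ge0.
Qed.

Theorem theorem2p5 (R : realType)
    (d : measure_display) (T : measurableType d) (P : probability T R)
    (X : {RV P >-> R}) (f : R -> R)
    (dU : measure_display) (TU : measurableType dU) (PU : probability TU R)
    (U : {RV PU >-> R})
    (n : nat) (a : R)
    (X_ge0 : {ae P, forall t, 0 <= X t})
    (f_pdf : is_pdf X f)
    (f_decr : forall x y : R, 0 <= x -> x <= y -> f y <= f x)
    (f0_le1 : f 0 <= 1)
    (U_unif : is_pdf U (uniform_pdf 0 1))
    (n_gt0 : (0 < n)%N) (a_gt0 : 0 < a) (a_neq1 : a != 1) :
  (tsallis_MRSSU U (uniform_pdf 0 1) n a <= tsallis_MRSSU X f n a)%E /\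
  tsallis_MRSSU U (uniform_pdf 0 1) n a =
    ((a - 1)^-1 *
     (1 - (n`!)%:R `^ a / \prod_(1 <= i < n.+1) (1 + a * (i%:R - 1))))%:E.
Proof.
have X0 : distribution P X `]-oo, 0[ = 0%E.
  rewrite /distribution/pushforward; apply: measure_negligible.
    by rewrite -[X in measurable X]setTI; exact: measurable_funP.
  apply: negligibleS X_ge0 => t /=; rewrite in_itv/= => Xt.
  by rewrite leNgt Xt.
have unif i : (1 <= i)%N ->
    (\int[lebesgue_measure]_(u in `[0%R, 1%R])
      (i%:R `^ a * u `^ (a * (i%:R - 1)) *
       uniform_pdf 0 1 (cdf_inv U u) `^ (a - 1))%:E =
    (i%:R `^ a / (1 + a * (i%:R - 1)))%:E)%E.
  move=> i1; under eq_integral => u.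
    rewrite inE/= in_itv/= => u01.
    rewrite uniform_pdf_cdf_inv// powR1 mulr1 EFinM; over.
  have ai : 0 <= a * (i%:R - 1) by rewrite mulr_ge0 ?subr_ge0 ?ler1n// ltW.
  rewrite ge0_integralZl//=.
  - by rewrite integral01_powR.
  - by apply/measurable_EFinP; exact: measurable_funTS.
  - by move=> u _; rewrite lee_fin powR_ge0.
have tsU : tsallis_MRSSU U (uniform_pdf 0 1) n a =
    ((a - 1)^-1 *
     (1 - (n`!)%:R `^ a / \prod_(1 <= i < n.+1) (1 + a * (i%:R - 1))))%:E.
  rewrite /tsallis_MRSSU.
  rewrite (eq_big_nat _ _ (F2 := fun i => (i%:R `^ a / (1 + a * (i%:R - 1)))%:E)).
    rewrite prodEFin big_split/= prodfV prod_powR// -natr_prod -fact_prod.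
    rewrite -EFinB -EFinM; congr EFin.
    by rewrite -opprB invrN mulNr -mulrN opprB.
  by move=> i /andP[i1 _]; exact: unif.
split => //; rewrite /tsallis_MRSSU.
have fX u : 0 <= u <= 1 -> 0 < f (cdf_inv X u) <= 1.
  move=> u01; rewrite (pdf_cdf_inv_gt0 _ _ _ _ _ X0)//=.
  apply: le_trans f0_le1; apply: f_decr => //; apply: cdf_inv_ge0 => //.
  by case/andP: u01.
have int_ge0 (g : R -> R) i : (0 <= \int[lebesgue_measure]_(u in `[0%R, 1%R])
    (i%:R `^ a * u `^ (a * (i%:R - 1)) * g u `^ (a - 1))%:E)%E.
  by apply: integral_ge0 => u _; rewrite lee_fin !mulr_ge0 ?powR_ge0.
have [a1|a1|/eqP] := ltgtP a 1; last by rewrite (negbTE a_neq1).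
- apply: lee_wpmul2l; first by rewrite lee_fin invr_ge0 subr_ge0 ltW.
  apply: leeB => //; apply: lee_prod_nat => [i|i _]; first exact: int_ge0.
  apply: ge0_le_integral_nonmeasurable => u; rewrite /= in_itv/= => u01.
    by rewrite lee_fin !mulr_ge0 ?powR_ge0.
  rewrite lee_fin ler_wpM2l ?mulr_ge0 ?powR_ge0//.
  (* Writing 1 as a zeroth power reduces the bound to comparing the exponents 0 and [a - 1] over a
     base in (0, 1]. *)
  rewrite uniform_pdf_cdf_inv// powR1 -[leLHS](powRr0 (f (cdf_inv X u))).
  by apply: ger_powR; [exact: fX|lra].
(* The prefactor is negative here, so cancelling it, through the negated strict inequality, reverses
   the comparison of the products. *)
- rewrite leNgt lte_nmul2l ?lte_fin ?invr_lt0 ?subr_lt0// -leNgt.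
  apply: leeB => //; apply: lee_prod_nat => [i|i _]; first exact: int_ge0.
  apply: ge0_le_integral_nonmeasurable => u; rewrite /= in_itv/= => u01.
    by rewrite lee_fin !mulr_ge0 ?powR_ge0.
  rewrite lee_fin ler_wpM2l ?mulr_ge0 ?powR_ge0//.
  rewrite uniform_pdf_cdf_inv// powR1 -[leRHS](powRr0 (f (cdf_inv X u))).
  by apply: ger_powR; [exact: fX|lra].
Qed.
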